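(* Let $X$ be a topological vector space, and let $B$ be a non-empty subset of $X$. Suppose that a family $\{F(x)\}_{x\in B}$ of convex subsets of $X$, indexed by $B$, has the Knaster–Kuratowski–Mazurkiewicz (KKM) property. If there exists $x_0\in B$ such that $F(x_0)$ is convexly compact, then $\bigcap_{x\in B}F(x)\neq\emptyset$.
   Context: Topological vector spaces are real. $\operatorname{conv}S$ denotes the convex hull of $S$. A convex subset $C$ of a topological vector space is convexly compact if for any non-empty index set $A$ and any family $\{F_\alpha\}_{\alpha\in A}$ of closed and convex subsets of $C$, the condition that $\bigcap_{\alpha\in D}F_\alpha\ne\emptyset$ for every non-empty finite $D\subseteq A$ implies $\bigcap_{\alpha\in A}F_\alpha\neq\emptyset$. A family $\{F(x)\}_{x\in B}$ of subsets of $X$, indexed by a non-empty set $B\subseteq X$, has the KKM property if (1) $F(x)$ is closed for each $x\in B$, and (2) $\operatorname{conv}\{x_1,\dots,x_n\}\subseteq\bigcup_{i=1}^nF(x_i)$ for any finite set $\{x_1,\dots,x_n\}\subseteq B$. *)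

(* Defs.v *)
From HB Require Import structures.
From mathcomp Require Import all_boot all_order all_algebra.
From mathcomp Require Import all_classical all_reals all_analysis.

Set Implicit Arguments.
Unset Strict Implicit.
Unset Printing Implicit Defensive.

Local Open Scope classical_set_scope.

Definition convex_hull (R : realType) (X : lmodType R) (S : set X) : set X :=
  smallest [set C : set X | convex_set C] S.

(* The members of the family are required to be closed in X, not merely
   relatively closed in C.  The two readings agree when C is closed. *)
Definition convexly_compact (R : realType) (X : topologicalLmodType R)
    (C : set X) : Prop :=
  convex_set C /\
  forall (A : Type) (F : A -> set X),
    [set: A] !=set0 ->
    (forall a, [/\ closed (F a), convex_set (F a) & F a `<=` C]) ->
    (forall D : set A, finite_set D -> D !=set0 ->
       \bigcap_(a in D) F a !=set0) ->
    \bigcap_(a in [set: A]) F a !=set0.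

(* The family is indexed by B: F is a total function, but its values outside
   B are irrelevant. *)
Definition KKM_property (R : realType) (X : topologicalLmodType R)
    (B : set X) (F : X -> set X) : Prop :=
  (forall x, B x -> closed (F x)) /\
  (forall S : set X, finite_set S -> S `<=` B ->
     convex_hull S `<=` \bigcup_(x in S) F x).

(* Main.v *)
Require Import Defs.
From HB Require Import structures.
From mathcomp Require Import all_boot all_order all_algebra.
From mathcomp Require Import all_classical all_reals all_analysis.
From mathcomp Require Import ring lra.

Set Implicit Arguments.
Unset Strict Implicit.
Unset Printing Implicit Defensive.

Import Order.TTheory GRing.Theory Num.Theory.
Import numFieldNormedType.Exports.

Local Open Scope classical_set_scope.
Local Open Scope ring_scope.

(** The sets F(x) ∩ F(x0) are closed convex subsets of F(x0), so convex compactness reduces the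
    theorem to a common point of finitely many F(x), x0 among them. [KKM_finite] finds such a point
    by induction on the number of points. Its inductive step is [convex_cover_bigcap]: if each y_j
    lies in every C_i with i != j and the closed convex sets C_i cover all convex combinations of
    the y_j, then one combination lies in all C_i. Because the C_i are convex, this follows from
    minimising a quadratic function over a compact set of weights, in place of a fixed point or
    labelling theorem. *)

Definition simplex (R : realType) (n : nat) : set ('I_n -> R) :=
  [set a | (forall i, 0 <= a i) /\ \sum_i a i = 1].

Lemma simplex_vertex (R : realType) n (j : 'I_n) :
  @simplex R n (fun i => (i == j)%:R).
Proof.
split=> [i|]; first exact: ler0n.
by rewrite (bigD1 j)//= eqxx big1 ?addr0// => i /negbTE ->.
Qed.

Lemma simplex_conv (R : realType) n (a b : 'I_n -> R) (t : R) :
  0 <= t <= 1 -> simplex a -> simplex b ->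
  simplex (fun i => t * a i + (1 - t) * b i).
Proof.
move=> /andP[t0 t1] [a0 a1] [b0 b1]; split=> [i|].
  by rewrite addr_ge0// mulr_ge0 ?subr_ge0.
by rewrite big_split/= -!mulr_sumr a1 b1 !mulr1 addrC subrK.
Qed.

Lemma convex_set_conv (R : realType) (X : lmodType R) (C : set X)
    (x y : X) (t : R) :
  convex_set C -> 0 <= t <= 1 -> C x -> C y -> C (t *: x + (1 - t) *: y).
Proof.
move=> cC /andP[t0 t1] Cx Cy.
have := cC x y (Itv01 t0 t1); rewrite !inE; exact.
Qed.

Lemma convex_set_sum (R : realType) (X : lmodType R) (C : set X) n
    (a : 'I_n -> R) (y : 'I_n -> X) :
  convex_set C -> simplex a -> (forall i, C (y i)) -> C (\sum_i a i *: y i).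
Proof.
move=> cC; elim: n a y => [|n IH] a y [a0 a1] Cy.
  by move: a1; rewrite big_ord0 => /esym/eqP; rewrite oner_eq0.
move: a1; rewrite !big_ord_recl => a1.
pose s := \sum_(i < n) a (lift ord0 i).
have s_ge0 : 0 <= s by apply: sumr_ge0.
have sE : s = 1 - a ord0 by rewrite -a1 addrC addKr.
have a01 : 0 <= a ord0 <= 1 by rewrite a0 -subr_ge0 -sE.
(* When s = 0 the tail cannot be renormalised to total weight 1, but then all its weights vanish. *)
have [s0|s0] := eqVneq s 0.
  rewrite big1 ?addr0 => [|i _].
    by move: sE; rewrite s0 => /esym/subr0_eq <-; rewrite scale1r.
  have /eqP := s0; rewrite psumr_eq0// => /allP/(_ i (mem_index_enum _))/eqP ->.
  by rewrite scale0r.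
have -> : \sum_(i < n) a (lift ord0 i) *: y (lift ord0 i) =
    (1 - a ord0) *: \sum_(i < n) (a (lift ord0 i) / s) *: y (lift ord0 i).
  rewrite scaler_sumr; apply: eq_bigr => i _.
  by rewrite scalerA -sE mulrCA divff// mulr1.
apply: convex_set_conv => //; apply: IH => //; split=> [i|].
  by rewrite divr_ge0.
by rewrite -mulr_suml divff.
Qed.

Lemma continuous_lincomb (R : realType) (X : topologicalLmodType R)
    (T : topologicalType) n (a : 'I_n -> T -> R) (y : 'I_n -> X) :
  (forall i, continuous (a i)) -> continuous (fun u => \sum_i a i u *: y i).
Proof.
move=> ca; apply: continuous_big => [|i _ u]; first exact: add_continuous.
apply: (@continuous2_cvg _ R^o X X _ _ (a i) (cst (y i)) (fun r x => r *: x)).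
- exact: (@scale_continuous R X (a i u, y i)).
- exact: ca.
- exact: cvg_cst.
Qed.

Lemma continuous_sumsq (R : realType) (T : topologicalType) n
    (a b : 'I_n -> T -> R) :
  (forall i, continuous (a i)) -> (forall i, continuous (b i)) ->
  continuous (fun u => \sum_i (a i u - b i u) ^+ 2).
Proof.
move=> ca cb; apply: continuous_big => [|i _ u]; first exact: add_continuous.
have cd : (a i - b i) w @[w --> u] --> a i u - b i u.
  by apply: cvgB; [exact: ca|exact: cb].
exact: (cvgM cd cd).
Qed.

(* Pull the C_i back to the simplex of weights, where squared distances make
   sense. Among all z in the simplex and c_i in C_i, minimise the sum of the
   |z - c_i|^2. If z lies in C_j, then moving z and all c_i with i != j towards
   the j-th vertex shrinks every |z - c_i| by the factor 1 - t, and replacing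
   c_j by the old z costs only a term of order t^2; hence the minimum is 0. *)
Lemma convex_cover_bigcap (R : realType) (X : topologicalLmodType R) n
    (C : 'I_n.+2 -> set X) (y : 'I_n.+2 -> X) :
  (forall i, closed (C i)) -> (forall i, convex_set (C i)) ->
  (forall i j, i != j -> C i (y j)) ->
  (forall a, simplex a -> exists i, C i (\sum_k a k *: y k)) ->
  exists2 a, simplex a & forall i, C i (\sum_k a k *: y k).
Proof.
move=> clC cC Cy Ccov.
(* A point of [P] is a table of weights: row [None] is z and row [Some i] represents c_i. As a
   product of copies of the line, it has a compact cube by Tychonoff. *)
pose T : Type := (option 'I_n.+2 * 'I_n.+2)%type.
pose P : topologicalType := prod_topology (fun _ : T => R).
pose comb (a : 'I_n.+2 -> R) := \sum_k a k *: y k.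
pose row (u : P) r : 'I_n.+2 -> R := fun k => u (r, k).
pose K : set P := [set u | forall r, simplex (row u r)] `&`
  [set u | forall i, C i (comb (row u (Some i)))].
pose q (a b : 'I_n.+2 -> R) := \sum_k (a k - b k) ^+ 2.
pose g (u : P) : R := \sum_i q (row u None) (row u (Some i)).
have cproj r k : continuous (fun u : P => row u r k).
  exact: (@proj_continuous T (fun _ => R) (r, k)).
have cg : continuous g.
  apply: continuous_big => [|i _]; first exact: add_continuous.
  by apply: continuous_sumsq => k; exact: cproj.
have compK : compact K.
  apply: (@subclosed_compact _ _
    [set u : P | forall t : T, `[0, 1]%classic (u t)]).
  - apply: closedI.
    + rewrite (_ : mkset _ = \bigcap_(r in setT) ((\bigcap_(k in setT)
          (fun u => row u r k) @^-1` [set x : R | 0 <= x]) `&`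
          (fun u => \sum_k row u r k) @^-1` [set x : R | x = 1])).
        apply: closed_bigI => r _; apply: closedI.
          apply: closed_bigI => k _; apply: preimage_closed; last exact: closed_ge.
          by move=> u _; exact: cproj.
        apply: preimage_closed; last exact: closed_eq.
        move=> u _; apply: continuous_big => [|k _]; first exact: add_continuous.
        exact: cproj.
      apply/seteqP; split=> u /= Ku r.
        by move=> _; have [u0 u1] := Ku r; split=> // k _; exact: u0.
      by have [u0 u1] := Ku r I; split=> // k; exact: u0.
    + rewrite (_ : mkset _ = \bigcap_(i in setT)
          ((fun u => comb (row u (Some i))) @^-1` C i)).
        apply: closed_bigI => i _; apply: preimage_closed; last exact: clC.
        move=> u _; apply: continuous_lincomb => k; exact: cproj.
      by apply/seteqP; split=> u /= Ku i; [move=> _|]; exact: Ku.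
  - apply: (@tychonoff T (fun _ => R) (fun _ => `[0, 1]%classic)) => _.
    exact: segment_compact.
  - move=> u [Ku _] [r k]; have [u0 u1] := Ku r.
    rewrite /= in_itv/=; apply/andP; split; first exact: u0.
    by rewrite -u1 (bigD1 k)//= lerDl sumr_ge0// => i _; exact: u0.
have comb_vertex j : comb (fun i => (i == j)%:R) = y j.
  rewrite /comb (bigD1 j)//= eqxx scale1r big1 ?addr0// => i /negbTE ->.
  by rewrite scale0r.
have comb_conv a b t :
    comb (fun k => t * a k + (1 - t) * b k) = t *: comb a + (1 - t) *: comb b.
  rewrite /comb !scaler_sumr -big_split/=; apply: eq_bigr => k _.
  by rewrite [LHS]scalerDl !scalerA.
have K0 : K !=set0.
  (* Having at least two indices provides some j(i) != i, and then y_{j(i)} can serve as c_i. *)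
  pose j (i : 'I_n.+2) : 'I_n.+2 := lift i ord0.
  exists ((fun t : T => (t.2 == j (odflt ord0 t.1))%:R) : P); split=> [r|i].
    exact: (simplex_vertex R (j (odflt ord0 r))).
  rewrite [comb _](comb_vertex (j i)); apply: Cy; exact: neq_lift.
have [u /set_mem[/= Ku KC] umin] :=
  compact_EVT_min K0 compK (continuous_subspaceT cg).
pose z := row u None.
have Sz : simplex z by exact: Ku.
have [j Cj] := Ccov _ Sz.
pose v := fun i => (i == j)%:R : R.
have q0 a b : 0 <= q a b by apply: sumr_ge0 => k _; exact: sqr_ge0.
pose S := \sum_(i | i != j) q z (row u (Some i)).
pose D := q v z.
(* The j-th term of the minimum is simply dropped: the bound on the competitor only has to be
   compared with the other terms. *)
have Sg : S <= g u by rewrite /g (bigD1 j)//= lerDr.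
have S0 : 0 <= S by apply: sumr_ge0 => i _; exact: q0.
have D0 : 0 <= D by exact: q0.
have step t : 0 <= t <= 1 -> S <= (1 - t) ^+ 2 * S + t ^+ 2 * D.
  move=> t01; apply: (le_trans Sg).
  (* Row [Some j] becomes the old z, which is allowed by [Cj]; the other rows stay admissible
     because C_i is convex and contains y_j for i != j. *)
  pose w : P := fun p : T =>
    if p.1 == Some j then z p.2 else t * v p.2 + (1 - t) * u p.
  have wK : K w.
    split=> [r|i].
      rewrite /row /w/=; have [_|_] := eqVneq r (Some j); first exact: Sz.
      by apply: simplex_conv => //; [exact: simplex_vertex|exact: Ku].
    rewrite /row /w/= (inj_eq Some_inj); have [->//|ij] := eqVneq i j.
    rewrite comb_conv comb_vertex; apply: convex_set_conv => //; exact: Cy.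
  apply: (le_trans (umin w (mem_set wK))).
  rewrite /g (bigD1 j)//= addrC; apply: lerD.
    rewrite /S mulr_sumr; apply: ler_sum => i /negbTE ij.
    rewrite /q mulr_sumr; apply: ler_sum => k _.
    rewrite /row /w/= (inj_eq Some_inj) ij /z /row.
    by rewrite le_eqVlt; apply/orP; left; apply/eqP; ring.
  rewrite /D /q mulr_sumr; apply: ler_sum => k _.
  rewrite /row /w/= eqxx /z /row.
  by rewrite le_eqVlt; apply/orP; left; apply/eqP; ring.
have {step} Seq0 : S = 0.
  apply/eqP; rewrite eq_le S0 andbT leNgt; apply/negP => Spos.
  have SD : 0 < S + D by rewrite ltr_pwDl.
  (* This t minimises (1 - t)^2 S + t^2 D; the value there is S - t S, which is less than S when S >
     0. *)
  have := step (S / (S + D)).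
  rewrite divr_ge0 ?(ltW SD)// ler_pdivrMr// mul1r lerDl D0.
  move=> /(_ isT); set t := S / (S + D).
  have tE : t * (S + D) = S by rewrite /t divfK// gt_eqF.
  have t0 : 0 < t by rewrite divr_gt0.
  have -> : (1 - t) ^+ 2 * S + t ^+ 2 * D =
    S - 2 * t * S + t * (t * (S + D)) by ring.
  rewrite tE; have := mulr_gt0 t0 Spos; lra.
exists z => // i; have [->//|ij] := eqVneq i j.
suff -> : z = row u (Some i) by exact: KC.
apply/funext => k; move/eqP: Seq0; rewrite psumr_eq0// =>
  /allP/(_ i (mem_index_enum _)).
rewrite ij/= psumr_eq0 => [|? _]; last exact: sqr_ge0.
by move=> /allP/(_ k (mem_index_enum _))/=; rewrite sqrf_eq0 subr_eq0 => /eqP.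
Qed.

Lemma convex_hull_convex (R : realType) (X : lmodType R) (S : set X) :
  convex_set (convex_hull S).
Proof.
move=> x y t; rewrite !inE => hx hy C [cC SC].
by have := cC x y t; rewrite !inE; apply; [exact: hx|exact: hy].
Qed.

(* Deleting x_i and applying the induction hypothesis gives y_i in every F_j
   with j != i; the y_i lie in the hull of the x_i, which the F_i cover. *)
Lemma KKM_finite (R : realType) (X : topologicalLmodType R)
    (B : set X) (F : X -> set X) n (x : 'I_n.+1 -> X) :
  (forall x, B x -> convex_set (F x)) -> KKM_property B F ->
  (forall i, B (x i)) ->
  exists2 p, convex_hull (range x) p & forall i, F (x i) p.
Proof.
move=> cF [clF covF].
(* The covering condition for indexed points; repetitions are harmless, as only the range
   matters. *)
have cov m (x' : 'I_m -> X) p : (forall i, B (x' i)) ->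
    convex_hull (range x') p -> exists i, F (x' i) p.
  move=> Bx hp; have fin : finite_set (range x').
    by apply: finite_image; exact: finite_finset.
  have sub : range x' `<=` B by move=> _ [i _ <-].
  by have [_ [i _ <-] Fp] := covF _ fin sub _ hp; exists i.
elim: n x => [|n IH] x Bx.
  have hx : convex_hull (range x) (x ord0).
    by apply: sub_gen_smallest; exists ord0.
  by exists (x ord0) => // i; have [j] := cov _ _ _ Bx hx; rewrite !ord1.
have /choice[y yP] i : exists p, convex_hull (range x) p /\
    forall j, i != j -> F (x j) p.
  have [p hp Fp] := IH (fun k => x (lift i k)) (fun k => Bx _).
  exists p; split.
    apply: sub_smallest2r hp; first exact: convex_hull_convex.
    by move=> _ [k _ <-]; exists (lift i k).
  by move=> j /unlift_some[k -> _]; exact: Fp.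
have hull a : simplex a -> convex_hull (range x) (\sum_k a k *: y k).
  move=> Sa; apply: convex_set_sum => //; first exact: convex_hull_convex.
  by move=> k; have [] := yP k.
have [| | | |a Sa Fa] := @convex_cover_bigcap R X n (fun i => F (x i)) y.
- by move=> i; exact: clF.
- by move=> i; exact: cF.
- by move=> i j; rewrite eq_sym; have [_] := yP j; exact.
- by move=> a /hull; exact: cov.
- by exists (\sum_k a k *: y k) => //; exact: hull.
Qed.

Theorem theorem4p8 (R : realType) (X : topologicalLmodType R)
    (B : set X) (F : X -> set X)
    (B_neq0 : B !=set0)
    (F_convex : forall x, B x -> convex_set (F x))
    (F_KKM : KKM_property B F)
    (F_compact : exists2 x0, B x0 & convexly_compact (F x0)) :
  \bigcap_(x in B) F x !=set0.
Proof.
have [x0 Bx0 [_ cpt]] := F_compact; have [clF _] := F_KKM.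
have BvalP (x : set_type B) : B (val x) by exact: set_mem (valP x).
have [|x|D /finite_seqP[s ->] _|p pP] :=
  cpt (set_type B) (fun x => F (val x) `&` F x0).
- by exists (exist _ x0 (mem_set Bx0)).
- split; last by move=> ? [].
    by apply: closedI; exact: clF.
  move=> a b t; rewrite !inE => -[xa x0a] [xb x0b].
  have := F_convex _ (BvalP x) a b t; have := F_convex x0 Bx0 a b t.
  by rewrite !inE => c0 c; split; [exact: c|exact: c0].
(* With x0 at the head, the list is non-empty and the common point lies in F(x0) as well; x0 may
   occur again in the tail. *)
- pose l := x0 :: map val s.
  have Bl (i : 'I_(size (map val s)).+1) : B (nth x0 l i).
    have : {in l, forall x, B x}.
      by move=> x; rewrite inE => /predU1P[->//|/mapP[z _ ->]].
    by apply; exact: mem_nth.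
  have [p _ Fp] := KKM_finite F_convex F_KKM Bl.
  exists p => z zs; split; last exact: (Fp ord0).
  have zl : val z \in l by rewrite inE map_f ?orbT.
  have := Fp (inord (index (val z) l)).
  by rewrite inordK ?nth_index//; rewrite -index_mem in zl.
- by exists p => x Bx; have [] := pP (exist _ x (mem_set Bx)) I.
Qed.
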